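(* (Binet-Cauchy identity) Let $\mathbb{F}$ be a field of characteristic not $2$ and let $B$ be an invertible symmetric $3\times 3$ matrix over $\mathbb{F}$. For all vectors $v_1,v_2,v_3,v_4\in\mathbb{V}^3=\mathbb{F}^3$, $$\left[v_1,v_2;v_3,v_4\right]_B=(\det B)\left[(v_1\cdot_B v_3)(v_2\cdot_B v_4)-(v_1\cdot_B v_4)(v_2\cdot_B v_3)\right].$$
   Context: $\mathbb{V}^3$ is the space of row vectors $(x,y,z)$ over $\mathbb{F}$. The $B$-scalar product is $v\cdot_B w=vBw^T$. The Euclidean vector product is $(x_1,y_1,z_1)\times(x_2,y_2,z_2)=(y_1z_2-y_2z_1,\;x_2z_1-x_1z_2,\;x_1y_2-x_2y_1)$. The $B$-vector product is $v\times_B w=(v\times w)\,\mathrm{adj}\,B$ (row vector times matrix), where $\mathrm{adj}\,B=(\det B)B^{-1}$ is the adjugate of $B$. The $B$-scalar quadruple product is $[v_1,v_2;v_3,v_4]_B=(v_1\times_B v_2)\cdot_B(v_3\times_B v_4)$. *)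

(* Defs.v *)
From mathcomp Require Import all_boot all_order all_algebra.

Set Implicit Arguments.
Unset Strict Implicit.
Unset Printing Implicit Defensive.

Import GRing.Theory.
Local Open Scope ring_scope.

(* The coordinates of v : 'rV_3 are (x, y, z) = (v 0 0, v 0 1, v 0 2); the
   column index 2 is the numeral of the ring structure on 'I_3 and has value 2. *)
Definition cross (F : fieldType) (v w : 'rV[F]_3) : 'rV[F]_3 :=
  \row_(j < 3) [:: v 0 1 * w 0 2 - w 0 1 * v 0 2;
                   w 0 0 * v 0 2 - v 0 0 * w 0 2;
                   v 0 0 * w 0 1 - w 0 0 * v 0 1]`_j.

(* The unique entry of the 1 x 1 matrix v B w^T. *)
Definition bdot (F : fieldType) (B : 'M[F]_3) (v w : 'rV[F]_3) : F :=
  (v *m B *m w^T) 0 0.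

(* \adj B is the transposed cofactor matrix, which equals \det B *: invmx B
   when B is invertible. *)
Definition bcross (F : fieldType) (B : 'M[F]_3) (v w : 'rV[F]_3) : 'rV[F]_3 :=
  cross v w *m \adj B.

Definition bquad (F : fieldType) (B : 'M[F]_3) (v1 v2 v3 v4 : 'rV[F]_3) : F :=
  bdot B (bcross B v1 v2) (bcross B v3 v4).

(* Main.v *)
Require Import Defs.
From mathcomp Require Import all_boot all_order all_algebra.
From mathcomp Require Import ring.

Import GRing.Theory.
Local Open Scope ring_scope.

(** Write c = v1 x v2 and d = v3 x v4.  Since adj B * B = det B, one factor
    adj B cancels in the quadruple product:
      c (adj B) B (d adj B)^T = det B * c (d adj B)^T.
    The adjugate is how a linear map acts on Euclidean vector products:
    [mulmx_cross] at the matrix B^T gives d adj B = (v3 B^T) x (v4 B^T).  What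
    is left is the Euclidean Binet-Cauchy identity [cross_dot_cross] for v1, v2,
    v3 B^T, v4 B^T, whose scalar products are v_i (v_j B^T)^T = v_i B v_j^T. *)

Lemma mulmx_sum3 (R : pzSemiRingType) m n (A : 'M[R]_(m, 3)) (B : 'M[R]_(3, n)) i j :
  (A *m B) i j = A i 0 * B 0 j + A i 1 * B 1 j + A i 2 * B 2 j.
Proof.
rewrite mxE !big_ord_recl big_ord0 addr0 addrA.
by congr (A i _ * B _ j + A i _ * B _ j + A i _ * B _ j); apply: val_inj.
Qed.

Lemma det_mx22 (R : comNzRingType) (A : 'M[R]_2) :
  \det A = A 0 0 * A 1 1 - A 0 1 * A 1 0.
Proof.
rewrite (expand_det_row _ 0) !big_ord_recl big_ord0 /cofactor !det_mx11 !mxE /=.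
have l0 : lift 0 0 = 1 :> 'I_2 by apply: val_inj.
have l1 : lift 1 0 = 0 :> 'I_2 by apply: val_inj.
by rewrite !l0 !l1 /=; ring.
Qed.

(** Cyclic indices absorb the sign (-1)^(i+j) of the cofactor, so that a single
    formula covers all nine entries. *)
Lemma cofactor3E (R : comNzRingType) (A : 'M[R]_3) (i j : 'I_3) :
  cofactor A i j =
  A (i + 1) (j + 1) * A (i + 2) (j + 2) - A (i + 1) (j + 2) * A (i + 2) (j + 1).
Proof.
rewrite /cofactor det_mx22 !mxE.
(* Reading entries at natural-number indices lets both the lifted indices of
   the minor and the indices taken mod 3 compute to numerals. *)
pose a (k l : nat) := A (inord k) (inord l).
have aE k l : A k l = a k l by rewrite /a !inord_val.
rewrite !aE.
by case: i => [[|[|[|//]]] ?]; case: j => [[|[|[|//]]] ?] /=;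
  rewrite /bump /=; ring.
Qed.

Lemma ord3P (P : 'I_3 -> Prop) : P 0 -> P 1 -> P 2 -> forall i, P i.
Proof.
move=> P0 P1 P2 [[|[|[|//]]] ltk3].
- by rewrite (_ : Ordinal _ = 0) //; apply: val_inj.
- by rewrite (_ : Ordinal _ = 1) //; apply: val_inj.
- by rewrite (_ : Ordinal _ = 2) //; apply: val_inj.
Qed.

(** The coordinates of v x w are the signed 2 x 2 minors of the matrix with rows
    v and w.  By the Cauchy-Binet formula, right multiplication by A transforms
    them by the matrix of signed 2 x 2 minors of A, which is (adj A)^T. *)
Lemma mulmx_cross (F : fieldType) (A : 'M[F]_3) (v w : 'rV[F]_3) :
  cross (v *m A) (w *m A) = cross v w *m (\adj A)^T.
Proof.
have e11 : 1 + 1 = 2 :> 'I_3 by apply: val_inj.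
have e12 : 1 + 2 = 0 :> 'I_3 by apply: val_inj.
have e21 : 2 + 1 = 0 :> 'I_3 by apply: val_inj.
have e22 : 2 + 2 = 1 :> 'I_3 by apply: val_inj.
apply/rowP; elim/ord3P; rewrite [LHS]mxE /= !mulmx_sum3 !mxE /= !cofactor3E;
  rewrite !add0r !(e11, e12, e21, e22); ring.
Qed.

Lemma cross_dot_cross (F : fieldType) (a b c d : 'rV[F]_3) :
  (cross a b *m (cross c d)^T) 0 0 =
  (a *m c^T) 0 0 * (b *m d^T) 0 0 - (a *m d^T) 0 0 * (b *m c^T) 0 0.
Proof. by rewrite !mulmx_sum3 !mxE /=; ring. Qed.

Theorem theorem7 (F : fieldType) (charF : 2%N \notin [pchar F])
    (B : 'M[F]_3) (B_unit : B \in unitmx) (B_sym : B^T = B)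
    (v1 v2 v3 v4 : 'rV[F]_3) :
  bquad B v1 v2 v3 v4 =
  \det B * (bdot B v1 v3 * bdot B v2 v4 - bdot B v1 v4 * bdot B v2 v3).
Proof.
have bdotE u v : bdot B u v = (u *m (v *m B^T)^T) 0 0.
  by rewrite trmx_mul trmxK mulmxA.
have bcrossE : bcross B v3 v4 = cross (v3 *m B^T) (v4 *m B^T).
  by rewrite mulmx_cross -trmx_adj trmxK.
rewrite /bquad {1}/bdot bcrossE /bcross -(mulmxA (cross v1 v2)) mul_adj_mx.
by rewrite mul_mx_scalar -scalemxAl mxE cross_dot_cross !bdotE.
Qed.
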